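(* For every positive integer $\ell$ there exists $n_0$ such that for all $n \geq n_0$ the following holds for the $4$-regular graph game on $n$ vertices: regardless of which player has the first move, a designated player (that is, either one of the two players) has a strategy which ensures, against any play of the opponent, that the graph resulting at the end of the game has a $K_\ell$ minor.
   Context: The $k$-regular graph game on $n$ vertices is the following two-player game. It starts with the empty graph (no edges) on $n$ vertices. The two players alternate turns; on each turn the player to move adds one edge between two distinct vertices which are currently nonadjacent and which each currently have degree at most $k-1$ (so the graph remains simple and all degrees remain at most $k$). Both players have the same available moves. The game ends when no such move is possible; the graph at that time is the resulting graph. A strategy is a rule specifying the player's move as a function of the game so far. $K_\ell$ denotes the complete graph on $\ell$ vertices. *)

(* Defs.v *)
From mathcomp Require Import all_boot.

Set Implicit Arguments.
Unset Strict Implicit.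
Unset Printing Implicit Defensive.

Section Graphs.

Variables V W : finType.

(* A simple graph on V is given by its adjacency relation (symmetric and
   irreflexive); an edge xy is the unordered pair [set x; y]. *)
Definition adj (E : {set {set V}}) : rel V :=
  [rel x y | (x != y) && ([set x; y] \in E)].

Definition degree (G : rel V) (v : V) : nat := #|[set w | G v w]|.

Definition connected_set (G : rel V) (A : {set V}) : Prop :=
  A != set0 /\
  {in A &, forall x y, connect [rel u v | [&& u \in A, v \in A & G u v]] x y}.

(* H is a minor of G: G contains disjoint connected branch sets, one for each
   vertex of H, with an edge of G between the branch sets of any two vertices
   adjacent in H. *)
Definition minor (H : rel W) (G : rel V) : Prop :=
  exists B : W -> {set V},
    [/\ forall i, connected_set G (B i),
        forall i j, i != j -> [disjoint B i & B j]
      & forall i j, H i j ->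
          exists x y, [/\ x \in B i, y \in B j & G x y]].

End Graphs.

Definition complete (l : nat) : rel 'I_l := [rel i j | i != j].

Arguments complete : clear implicits.

Section Game.

Variables k n : nat.

Definition move := {set 'I_n}.

(* The moves made so far, oldest first. *)
Definition history := seq move.

Definition graph_of (h : history) : rel 'I_n := adj [set e in h].

Definition legal_move (h : history) (e : move) : bool :=
  [exists x, exists y,
    [&& e == [set x; y], x != y, ~~ graph_of h x y,
        degree (graph_of h) x < k & degree (graph_of h) y < k]].

Definition legal_history (h : history) : Prop :=
  forall i, i < size h -> legal_move (take i h) (nth set0 h i).

Definition game_over (h : history) : Prop := forall e, ~~ legal_move h e.

(* The two players are the two booleans; f is the one who moves first. *)
Definition to_move (f : bool) (h : history) : bool := f (+) odd (size h).

Definition strategy := history -> move.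

(* The values of a strategy are constrained only where player p has to move
   and some move is available. *)
Definition is_strategy (f p : bool) (s : strategy) : Prop :=
  forall h, legal_history h -> to_move f h = p -> ~ game_over h ->
    legal_move h (s h).

Definition follows (f p : bool) (s : strategy) (h : history) : Prop :=
  forall i, i < size h -> to_move f (take i h) = p ->
    nth set0 h i = s (take i h).

(* With f moving first, player p can force the final graph to satisfy Q. *)
Definition can_ensure (f p : bool) (Q : rel 'I_n -> Prop) : Prop :=
  exists s : strategy, is_strategy f p s /\
    forall h, legal_history h -> game_over h -> follows f p s h ->
      Q (graph_of h).

End Game.

(* Main.v *)
Require Import Defs.
From mathcomp Require Import all_boot.
From mathcomp Require Import zify.
From Stdlib Require Import Classical ClassicalEpsilon.

(** Call the slack of a vertex set the number of edges that its vertices can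
    still take before all of them have degree 4.  The player grows many disjoint
    connected sets of large slack.  Once there are [l] of them with slack at
    least [4 * l ^ 2], one edge is added between any two that are not yet
    adjacent: a round costs each set at most 4 units of slack, so this never
    gets stuck, and the sets become the branch sets of a complete minor
    ([linking_phase]).

    Slack is raised by a merging phase ([merging_phase]): from many disjoint
    connected sets of slack at least [c], repeatedly join two sets that the
    opponent has not touched.  After [T] merges the unions start out with slack
    at least [2c - 2], and the opponent has played at most [T] edges, whose [2T]
    ends are the only further losses.  For [c >= 5] a union falls below
    [c + 1] only when it absorbs at least 3 ends, so a third of the unions
    survive ([survivors_large]), and iterating gives any slack.

    The delicate step is the first one, from isolated vertices ([c = 4]) to
    slack 5: there the phase produces [T] disjoint edges of slack 6, and the
    opponent can afford to put two ends on each of them.  But an opponent's edge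
    cannot lie inside such a pair, so it leads elsewhere, and if it leads to
    another pair the two pairs form a connected set, in which the slacks add up.
    Taking a maximal disjoint family of good sets, each a pair or the union of
    two linked pairs, a discharging argument bounds the pairs that avoid the
    family: two of them that are linked carry at least 8 ends together, while
    the average number of ends is only 2 ([survivors_pairs]).

    Neither the starting player nor the end of the game matters in this plan, so
    it is carried out in a simplified game on edge sets in which the opponent
    may also pass ([forced]). *)

Set Implicit Arguments.
Unset Strict Implicit.
Unset Printing Implicit Defensive.

(** * From forced positions to strategies *)

Section Strategy.

Variables k n : nat.
Variable Q : rel 'I_n -> Prop.
Implicit Types (E : {set {set 'I_n}}) (e : {set 'I_n}) (h : history n).

Definition legal E e : bool :=
  [exists x, exists y,
    [&& e == [set x; y], x != y, ~~ adj E x y,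
        degree (adj E) x < k & degree (adj E) y < k]].

(** Positions at the turn of the designated player from which that player can
    force [Q].  After each move the opponent may also pass: this only helps the
    opponent, and it spares proving that the game goes on after every move.
    A position where the game is over can be [forced] only by [forced_now]. *)
Inductive forced E : Prop :=
  | forced_now of Q (adj E)
  | forced_move e of legal E e & forced (e |: E)
      & forall e', legal (e |: E) e' -> forced (e' |: (e |: E)).

Definition good_move E e :=
  [/\ legal E e, forced (e |: E)
    & forall e', legal (e |: E) e' -> forced (e' |: (e |: E))].

Hypothesis Qmono : forall E E', E \subset E' -> Q (adj E) -> Q (adj E').

Lemma edges_rcons h e : [set e' in rcons h e] = e |: [set e' in h].
Proof. by apply/setP => a; rewrite !inE mem_rcons inE. Qed.

Lemma legal_history_rcons h e :
  legal_history k (rcons h e) -> legal_history k h /\ legal_move k h e.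
Proof.
move=> H; split=> [i ih|].
  have := H i; rewrite size_rcons ltnS => /(_ (ltnW ih)).
  by rewrite nth_rcons ih -cats1 takel_cat // ltnW.
have last_e : nth set0 (rcons h e) (size h) = e by rewrite nth_rcons ltnn eqxx.
have take_h : take (size h) (rcons h e) = h by rewrite -cats1 takel_cat ?take_size.
have := H (size h); rewrite last_e take_h size_rcons; apply; exact: leqnn.
Qed.

Lemma follows_rcons f p s h e :
  follows f p s (rcons h e) ->
  follows f p s h /\ (to_move f h = p -> e = s h).
Proof.
move=> H; split=> [i ih|].
  have := H i; rewrite size_rcons ltnS => /(_ (ltnW ih)).
  by rewrite nth_rcons ih -cats1 takel_cat // ltnW.
have last_e : nth set0 (rcons h e) (size h) = e by rewrite nth_rcons ltnn eqxx.
have take_h : take (size h) (rcons h e) = h by rewrite -cats1 takel_cat ?take_size.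
have := H (size h); rewrite last_e take_h size_rcons; apply; exact: leqnn.
Qed.

(** A good move whenever there is one; otherwise an arbitrary legal move, which
    does no harm when [Q] already holds since [Q] is monotone. *)
Definition forcing_strategy : strategy n := fun h =>
  epsilon (inhabits set0) (fun e => legal_move k h e /\
    ((exists e', good_move [set a in h] e') -> good_move [set a in h] e)).

Lemma forcing_strategyP h : ~ game_over k h ->
  legal_move k h (forcing_strategy h) /\
  ((exists e, good_move [set a in h] e) ->
     good_move [set a in h] (forcing_strategy h)).
Proof.
move=> nover; rewrite /forcing_strategy; set P := (fun e => _ /\ _).
apply: (epsilon_spec (inhabits set0) P).
have [[e He]|no] := classic (exists e, good_move [set a in h] e).
  by exists e; split=> //; case: He.
have [e /negP /negbNE He] := not_all_ex_not _ _ nover.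
by exists e; split=> // /no.
Qed.

(** The invariant along any play that follows the strategy.  At the opponent's
    turn, the position is forced whether the opponent passes or moves; hence it
    is forced at the end of the game, whatever the parity of the number of moves. *)
Lemma forced_game (f p : bool) h :
  (f = p -> forced set0) ->
  (f <> p -> forced set0 /\ forall e, legal set0 e -> forced (e |: set0)) ->
  legal_history k h -> follows f p forcing_strategy h ->
  forced [set e in h] /\
  (to_move f h <> p ->
     forall e, legal_move k h e -> forced (e |: [set a in h])).
Proof.
move=> init_p init_o; elim/last_ind: h => [|h e IH] legh folh.
  have E0 : [set e : {set 'I_n} in [::]] = set0 by apply/setP => a; rewrite !inE.
  rewrite /to_move /= addbF; have [fp|fp] := eqVneq f p.
    by rewrite E0; split=> [|[]]; first exact: init_p.
  have [H0 H1] := init_o (elimN eqP fp); by rewrite E0; split.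
have [legh' lege] := legal_history_rcons legh.
have [folh' es] := follows_rcons folh.
have [forced_h Hopp] := IH legh' folh'.
rewrite edges_rcons.
have turn : to_move f (rcons h e) = ~~ to_move f h.
  by rewrite /to_move size_rcons /= addbN.
(* Once [Q] holds it holds forever, whatever is played. *)
have now : Q (adj [set a in h]) ->
    forced (e |: [set a in h]) /\
    (to_move f (rcons h e) <> p -> forall a, legal_move k (rcons h e) a ->
      forced (a |: (e |: [set a in h]))).
  move=> q; have q1 : Q (adj (e |: [set a in h])) by apply: Qmono q; apply: subsetUr.
  split=> [|_ a _]; apply: forced_now => //.
  by apply: Qmono q1; apply: subsetUr.
have [tp|tp] := eqVneq (to_move f h) p.
  have [_ good_s] : legal_move k h e /\
      ((exists e, good_move [set a in h] e) -> good_move [set a in h] e).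
    by rewrite es //; apply: forcing_strategyP => over; have := over e; rewrite lege.
  have [Hgood|no] := classic (exists e, good_move [set a in h] e).
    have [_ f1 f2] := good_s Hgood; split; first exact: f1.
    by move=> _ a; rewrite /legal_move /graph_of edges_rcons; apply: f2.
  case: forced_h => [/now //|a la f1 f2].
  by case: no; exists a; split.
split; first by apply: Hopp => //; apply/eqP.
have neg_ne (a b : bool) : a != b -> ~~ a = b by case: a b => [] [].
by rewrite turn => /(_ (neg_ne _ _ tp)).
Qed.

Lemma can_ensure_forced (f p : bool) :
  forced set0 -> (forall e, legal set0 e -> forced (e |: set0)) ->
  can_ensure k f p Q.
Proof.
move=> f0 f1; exists forcing_strategy; split=> [h _ _ /forcing_strategyP[] //|].
move=> h legh over folh.
have [win _] := forced_game (fun _ => f0) (fun _ => conj f0 f1) legh folh.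
case: win => [q|e le _ _]; first exact: q.
by have /negP[] := over e.
Qed.

End Strategy.

Arguments legal k {n} E e.
Arguments forced k {n} Q E.

(** * Connected sets and slack *)

Section ConnectedSets.

Variable V : finType.
Implicit Types (G : rel V) (A B : {set V}) (E : {set {set V}}).

Lemma adj_sym E : symmetric (adj E).
Proof. by move=> x y; rewrite /adj /= eq_sym setUC. Qed.

Lemma adjS E E' : E \subset E' -> subrel (adj E) (adj E').
Proof. by move=> /subsetP sub x y /andP[xy /sub]; rewrite /adj /= xy. Qed.

Lemma connected_setS G G' A :
  subrel G G' -> connected_set G A -> connected_set G' A.
Proof.
move=> sub [A0 conA]; split=> // x y xA yA.
apply: connect_sub (conA x y xA yA) => u v /and3P[uA vA uv].
by apply: connect1; rewrite /= uA vA sub.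
Qed.

Lemma connected_set1 G x : connected_set G [set x].
Proof.
split=> [|u v /set1P-> /set1P->]; last exact: connect0.
by apply/set0Pn; exists x; rewrite set11.
Qed.

Lemma connected_setU G A B x y : symmetric G ->
    connected_set G A -> connected_set G B -> x \in A -> y \in B -> G x y ->
  connected_set G (A :|: B).
Proof.
move=> symG [A0 conA] [_ conB] xA yB xy; split.
  by apply/set0Pn; exists x; rewrite inE xA.
set r := [rel u v | [&& u \in A :|: B, v \in A :|: B & G u v]].
have inA u v : u \in A -> v \in A -> connect r u v.
  move=> uA vA; apply: connect_sub (conA u v uA vA) => a b /and3P[aA bA ab].
  by apply: connect1; rewrite /r /= !inE aA bA ab.
have inB u v : u \in B -> v \in B -> connect r u v.
  move=> uB vB; apply: connect_sub (conB u v uB vB) => a b /and3P[aB bB ab].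
  by apply: connect1; rewrite /r /= !inE aB bB ab !orbT.
have rxy : connect r x y by apply: connect1; rewrite /r /= !inE xA yB xy !orbT.
have ryx : connect r y x.
  by apply: connect1; rewrite /r /= !inE xA yB symG xy !orbT.
move=> u v /setUP[uA|uB] /setUP[vA|vB].
- exact: inA.
- exact: connect_trans (inA _ _ uA xA) (connect_trans rxy (inB _ _ yB vB)).
- exact: connect_trans (inB _ _ uB yB) (connect_trans ryx (inA _ _ xA vA)).
- exact: inB.
Qed.

Lemma card_setI A B : #|A :&: B| = \sum_(x in B) (x \in A).
Proof.
rewrite -sum1_card big_mkcond [RHS]big_mkcond.
by apply: eq_bigr => x _; rewrite inE; case: (x \in A) (x \in B) => [] [].
Qed.

Lemma sum_setU (F : V -> nat) A B : [disjoint A & B] ->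
  \sum_(x in A :|: B) F x = \sum_(x in A) F x + \sum_(x in B) F x.
Proof.
by move=> dAB; rewrite -bigU //=; apply: eq_bigl => x; rewrite !inE.
Qed.

Lemma sum_card_trivIset (S : {set {set V}}) A :
  trivIset S -> \sum_(P in S) #|A :&: P| <= #|A|.
Proof.
move=> tS; under eq_bigr do rewrite card_setI.
rewrite -(@big_trivIset _ _ _ _ S (fun x => nat_of_bool (x \in A))) //= -card_setI.
by rewrite subset_leq_card // subsetIl.
Qed.

(** The two ends of an edge lie in at most two members of a disjoint family. *)
Lemma touched_le (S : {set {set V}}) (e : {set V}) : trivIset S -> #|e| = 2 ->
  #|S| <= #|[set P in S | [disjoint e & P]]| + 2.
Proof.
move=> tS e2; rewrite -(cardsID [set P : {set V} | [disjoint e & P]] S).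
have -> : S :&: [set P : {set V} | [disjoint e & P]] =
    [set P in S | [disjoint e & P]].
  by apply/setP => P; rewrite !inE.
rewrite leq_add2l -[in X in _ <= X]e2; apply: leq_trans (sum_card_trivIset e tS).
rewrite (big_setID [set P : {set V} | [disjoint e & P]]) /= -sum1_card.
apply: leq_trans (leq_addl _ _); apply: leq_sum => P.
by rewrite !inE => /andP[+ _]; rewrite -setI_eq0 -card_gt0.
Qed.

End ConnectedSets.

Section Slack.

Variable n : nat.
Implicit Types (E U S F : {set {set 'I_n}}) (A B P e : {set 'I_n}).

Lemma legal_edge k E e : legal k E e ->
  exists x y, [/\ e = [set x; y], x != y, ~~ adj E x y,
    degree (adj E) x < k & degree (adj E) y < k].
Proof.
by case/existsP=> x /existsP[y /and5P[/eqP-> ? ? ? ?]]; exists x, y; split.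
Qed.

Lemma legal_card k E e : legal k E e -> #|e| = 2.
Proof. by case/legal_edge=> x [y [-> xy _ _ _]]; rewrite cards2 xy. Qed.

Lemma legal_notin k E e : legal k E e -> e \notin E.
Proof. by case/legal_edge=> x [y [-> xy + _ _]]; rewrite /adj /= xy. Qed.

Lemma legal_intro k E x y :
    x != y -> ~~ adj E x y ->
    degree (adj E) x < k -> degree (adj E) y < k -> legal k E [set x; y].
Proof.
move=> xy nadj dx dy; apply/existsP; exists x; apply/existsP; exists y.
by rewrite eqxx xy nadj dx dy.
Qed.

Lemma degree_add E e x : #|e| = 2 ->
  degree (adj (e |: E)) x <= degree (adj E) x + (x \in e).
Proof.
move=> e2; rewrite /degree.
have sub : [set w | adj (e |: E) x w] \subset
    [set w | adj E x w] :|: (if x \in e then e :\ x else set0).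
  apply/subsetP => w; rewrite !inE /adj /= => /andP[xw].
  rewrite xw !inE => /orP[/eqP <-|-> //].
  by rewrite !inE eqxx /= !inE eqxx orbT eq_sym xw orbT.
apply: leq_trans (subset_leq_card sub) _; apply: leq_trans (leq_card_setU _ _) _.
rewrite leq_add2l; case: ifP => xe; last by rewrite cards0.
by have := cardsD1 x e; rewrite xe e2 /= add1n => -[<-].
Qed.

(** Subtraction is truncated, so no bound on the degrees needs to be carried
    along: adding an edge still lowers the slack of [A] by at most the number of
    its ends in [A]. *)
Definition slack E A := \sum_(x in A) (4 - degree (adj E) x).

Lemma slack_add E e A :
  #|e| = 2 -> slack E A <= slack (e |: E) A + #|e :&: A|.
Proof.
move=> e2; rewrite card_setI /slack -big_split /=.
apply: leq_sum => x _; have := degree_add E x e2.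
by move: (nat_of_bool _) (degree _ x) (degree _ x); lia.
Qed.

Lemma slackU E A B :
  [disjoint A & B] -> slack E (A :|: B) = slack E A + slack E B.
Proof. exact: sum_setU. Qed.

Lemma slack_gt0 E A : 0 < slack E A ->
  exists2 x, x \in A & degree (adj E) x < 4.
Proof.
rewrite lt0n sum_nat_eq0 => /forall_inPn[x xA]; rewrite subn_eq0 -ltnNge.
by exists x.
Qed.

End Slack.

(** * The merging phase *)

Section Merging.

Variable n : nat.
Implicit Types (E U S F X : {set {set 'I_n}}) (A B C P e : {set 'I_n}).

Definition touch X P := \sum_(e in X) #|e :&: P|.

(** The state of a merging phase that started from the family [U0]: [U] is the
    part of [U0] that nobody has used so far, [S] consists of the unions made,
    and [X] of the opponent's edges since the start.  In [slackS], the 2 is the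
    cost of the joining edge; it is on the right to avoid truncation.  The field
    [twoS] is there for the first phase, where the unions are edges: it says
    that no opponent's edge has both ends in the same union. *)
Record merging c U0 E U S X : Prop := Merging {
  trivU : trivIset U;
  trivS : trivIset S;
  subU : U \subset U0;
  connU : forall A, A \in U -> connected_set (adj E) A;
  slackUc : forall A, A \in U -> c <= slack E A;
  disjUS : forall A P, A \in U -> P \in S -> [disjoint A & P];
  freshU : forall A e, A \in U -> e \in X -> [disjoint e & A];
  connS : forall P, P \in S -> connected_set (adj E) P;
  slackS : forall P, P \in S -> 2 * c <= slack E P + touch X P + 2;
  pairS : forall P, P \in S ->
    exists A B, [/\ A \in U0, B \in U0, A != B & P = A :|: B];
  edgeX : forall e, e \in X -> e \in E /\ #|e| = 2;
  twoS : forall P, P \in S -> #|P| = 2 -> P \in E /\ P \notin X }.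

Lemma disjoint_mem A B x : [disjoint A & B] -> x \in A -> x \notin B.
Proof. by move=> d xA; rewrite (disjointFr d xA). Qed.

(** The new edge set [E'] is [E] itself when the two sets are already adjacent, so
    that no move is spent, and [E] with the edge [xy] otherwise. *)
Lemma merging_pair c U0 E E' U S X A B x y :
    merging c U0 E U S X -> A \in U -> B \in U -> A != B ->
    x \in A -> y \in B -> E \subset E' -> adj E' x y ->
    (forall C, slack E C <= slack E' C + #|[set x; y] :&: C|) ->
  merging c U0 E' (U :\ A :\ B) (A :|: B |: S) X /\
  #|A :|: B |: S| = #|S|.+1.
Proof.
move=> M AU BU AB xA yB EE' xy le_slack.
have [tU tS sU cU lU dUS fU cS lS pS eX twS] := M.
have dAB : [disjoint A & B] by move/trivIsetP: tU; apply.
have far C : [disjoint A & C] -> [disjoint B & C] -> slack E C <= slack E' C.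
  move=> dA dB; apply: leq_trans (le_slack C) _.
  suff -> : [set x; y] :&: C = set0 by rewrite cards0 addn0.
  apply/setP => z; rewrite !inE; apply/negbTE.
  apply/negP => /andP[/orP[] /eqP->]; apply/negP.
    exact: disjoint_mem dA xA.
  exact: disjoint_mem dB yB.
have dABS P : P \in S -> [disjoint A :|: B & P].
  by move=> PS; rewrite -setI_eq0 setIUl setU_eq0 !setI_eq0 !dUS.
have ABnS : A :|: B \notin S.
  apply/negP => /(dUS _ _ AU) d.
  by have := disjoint_mem d xA; rewrite inE xA.
split; last by rewrite cardsU1 ABnS.
have inU C : C \in U :\ A :\ B -> [/\ C \in U, [disjoint A & C] & [disjoint B & C]].
  rewrite !inE => /and3P[CB CA CU]; split=> //; move/trivIsetP: tU; apply=> //.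
    by rewrite eq_sym.
  by rewrite eq_sym.
have set0S : set0 \notin S by apply/negP => /cS[]; rewrite eqxx.
split.
- by apply: trivIsetS tU; apply/subsetP => C /inU[].
- by case: (trivIsetU1 dABS tS set0S).
- by apply: subset_trans sU; apply/subsetP => C /inU[].
- by move=> C /inU[CU _ _]; apply: connected_setS (cU C CU); apply: adjS.
- by move=> C /inU[CU dA dB]; apply: leq_trans (lU C CU) (far _ dA dB).
- move=> C P /inU[CU dA dB] /setU1P[->|]; last exact: dUS.
  by rewrite disjoint_sym -setI_eq0 setIUl setU_eq0 !setI_eq0 dA.
- by move=> C e /inU[CU _ _]; apply: fU.
- move=> P /setU1P[->|PS]; last by apply: connected_setS (cS P PS); apply: adjS.
  have sub := adjS EE'.
  apply: connected_setU xA yB xy; first exact: adj_sym.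
    exact: connected_setS (cU A AU).
  exact: connected_setS (cU B BU).
- move=> P /setU1P[->|PS].
    have := le_slack (A :|: B); rewrite slackU //.
    have := lU A AU; have := lU B BU.
    have : #|[set x; y] :&: (A :|: B)| <= 2.
      apply: leq_trans (subset_leq_card (subsetIl _ _)) _.
      by rewrite cards2; case: eqP.
    by clear; lia.
  have dABP := dABS P PS; have := lS P PS; have : slack E P <= slack E' P.
    by apply: far; apply: dUS.
  by clear; lia.
- move=> P /setU1P[->|]; last exact: pS.
  by exists A, B; split=> //; apply: (subsetP sU).
- by move=> e /eX[eE]; split=> //; apply: (subsetP EE').
- move=> P /setU1P[->|PS P2]; last first.
    by have [PE PX] := twS P PS P2; split=> //; apply: (subsetP EE').
  have xny : x != y by apply: contraTneq yB => <-; apply: disjoint_mem dAB xA.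
  move=> card2.
  have <- : [set x; y] = A :|: B.
    apply/eqP; rewrite eqEcard card2 cards2 xny andbT.
    by apply/subsetP => z; rewrite !inE => /orP[] /eqP->; rewrite ?xA ?yB ?orbT.
  split; first by case/andP: xy.
  apply/negP => /(fU A _ AU) d.
  by have := disjoint_mem d (set21 x y); rewrite xA.
Qed.

Lemma merging_reply c U0 E U S X e :
    merging c U0 E U S X -> legal 4 E e ->
  merging c U0 (e |: E) [set A in U | [disjoint e & A]] S (e |: X).
Proof.
case=> tU tS sU cU lU dUS fU cS lS pS eX twS le.
have e2 := legal_card le; have eE := legal_notin le.
have EE : E \subset e |: E by apply: subsetUr.
have enX : e \notin X by apply/negP => /eX[]; rewrite (negbTE eE).
have inU A : A \in [set A in U | [disjoint e & A]] -> A \in U /\ [disjoint e & A].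
  by rewrite inE => /andP[].
split.
- by apply: trivIsetS tU; apply/subsetP => A /inU[].
- exact: tS.
- by apply: subset_trans sU; apply/subsetP => A /inU[].
- by move=> A /inU[AU _]; apply: connected_setS (cU A AU); apply: adjS.
- move=> A /inU[AU dA]; have := slack_add E A e2; have := lU A AU.
  by move: dA; rewrite -setI_eq0 => /eqP->; rewrite cards0; clear; lia.
- by move=> A P /inU[AU _]; apply: dUS.
- by move=> A a /inU[AU dA] /setU1P[-> //|]; apply: fU.
- by move=> P PS; apply: connected_setS (cS P PS); apply: adjS.
- move=> P PS.
  have -> : touch (e |: X) P = #|e :&: P| + touch X P by rewrite /touch big_setU1.
  by have := slack_add E P e2; have := lS P PS; clear; lia.
- exact: pS.
- by move=> a /setU1P[->|/eX[aE ?]]; rewrite !inE ?eqxx // aE orbT.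
- move=> P PS P2; have [PE PX] := twS P PS P2; rewrite !inE PE orbT negb_or PX.
  by split=> //; rewrite andbT; apply: contraNneq eE => <-.
Qed.

(** A round uses up two sets of [U] by the merge and at most two by the reply,
    whence the factor 4. *)
Lemma merging_phase Q c U0 T k E U S X :
    0 < c -> merging c U0 E U S X ->
    #|S| + k = T -> 4 * k <= #|U| -> #|X| <= #|S| ->
    (forall E' U' S' X', merging c U0 E' U' S' X' -> #|S'| = T -> #|X'| <= T ->
       forced 4 Q E') ->
  forced 4 Q E.
Proof.
move=> c0 + + + + fin; elim: k E U S X => [|k IH] E U S X M cS cU cX.
  by apply: fin M _ _; move: cS cX; clear; lia.
have /card_gt1P[A [B [AU BU AB]]] : 1 < #|U| by move: cU; clear; lia.
have [x xA dx] : exists2 x, x \in A & degree (adj E) x < 4.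
  by apply: slack_gt0; apply: leq_trans c0 (slackUc M AU).
have [y yB dy] : exists2 y, y \in B & degree (adj E) y < 4.
  by apply: slack_gt0; apply: leq_trans c0 (slackUc M BU).
have dAB : [disjoint A & B] by move/trivIsetP: (trivU M); apply.
have xy : x != y by apply: contraTneq yB => <-; apply: disjoint_mem dAB xA.
have cU' : #|U :\ A :\ B| + 2 = #|U|.
  by rewrite (cardsD1 A U) AU (cardsD1 B (U :\ A)) !inE BU eq_sym AB; clear; lia.
have [adjxy|nadj] := boolP (adj E x y).
  have [|M' cS'] := merging_pair M AU BU AB xA yB (subxx E) adjxy.
    by move=> C; apply: leq_addr.
  apply: IH M' _ _ _; rewrite ?cS';
    by move: cS cU cX cU'; clear; move: #|_ :\ _|; lia.
have le := legal_intro xy nadj dx dy; set e := [set x; y] in le.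
have adjxy : adj (e |: E) x y by rewrite /adj /= xy !inE eqxx.
have [|M' cS'] := merging_pair M AU BU AB xA yB (subsetUr [set e] E) adjxy.
  by move=> C; apply/slack_add/legal_card/le.
apply: (forced_move le) => [|e' le'].
  apply: IH M' _ _ _; rewrite ?cS';
    by move: cS cU cX cU'; clear; move: #|_ :\ _|; lia.
have eX : e' \notin X.
  apply/negP => /(edgeX M)[e'E _].
  by have := legal_notin le'; rewrite !inE e'E orbT.
have tl := touched_le (trivU M') (legal_card le').
apply: IH (merging_reply M' le') _ _ _; rewrite ?cS' ?cardsU1 ?eX;
  by move: cS cU cX cU' tl; clear; move: #|_ :\ _| #|[set _ in _ | _]|; lia.
Qed.

End Merging.

(** * What the opponent cannot destroy *)

Section Survivors.

Variable n : nat.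
Implicit Types (E U S F X : {set {set 'I_n}}) (A B C P e : {set 'I_n}).

Definition family c E F :=
  trivIset F /\ forall A, A \in F -> connected_set (adj E) A /\ c <= slack E A.

Lemma sum_touch c U0 E U S X :
  merging c U0 E U S X -> \sum_(P in S) touch X P <= 2 * #|X|.
Proof.
move=> M; rewrite /touch exchange_big /= mulnC -sum_nat_const.
apply: leq_sum => e /(edgeX M)[_ <-].
exact: sum_card_trivIset (trivS M).
Qed.

(** A union that misses slack [c + 1] has been hit at least [c - 2 >= 3] times,
    while there are at most [2 * #|S|] hits in all. *)
Lemma survivors_large c U0 E U S X :
    5 <= c -> merging c U0 E U S X -> #|X| <= #|S| ->
  exists2 F, family c.+1 E F & #|S| <= 3 * #|F|.
Proof.
move=> c5 M cX; pose L := [set P | touch X P <= 2]; exists (S :&: L).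
  split=> [|P]; first by apply: trivIsetS (trivS M); apply: subsetIl.
  rewrite !inE => /andP[PS light]; split; first exact: (connS M).
  by move: (slackS M PS) light c5; clear; lia.
have heavy : 3 * #|S :\: L| <= 2 * #|X|.
  apply: leq_trans (sum_touch M); rewrite mulnC -sum_nat_const.
  rewrite [X in _ <= X](big_setID L) /=; apply: leq_trans (leq_addl _ _).
  by apply: leq_sum => P; rewrite !inE -ltnNge => /andP[].
move: (cardsID L S) heavy cX; move: #|S :&: L| #|S :\: L| #|S| #|X|; clear; lia.
Qed.

Section Pairs.

Variables (E U0 U S X : {set {set 'I_n}}).
Hypothesis M : merging 4 U0 E U S X.
Hypothesis cX : #|X| <= #|S|.
Hypothesis S2 : forall P, P \in S -> #|P| = 2.

Definition linked P P' :=
  (P != P') && [exists e in X, ~~ [disjoint e & P] && ~~ [disjoint e & P']].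

(** The sets from which the surviving family is chosen.  Connectedness is left
    out to keep the predicate boolean; it holds by [candidate_connected]. *)
Definition candidate C :=
  (5 <= slack E C) && ((C \in S) ||
    [exists P in S, exists P' in S, linked P P' && (C == P :|: P')]).

Lemma disjointS P P' : P \in S -> P' \in S -> P != P' -> [disjoint P & P'].
Proof. by move=> PS PS' PP'; move/trivIsetP: (trivS M); apply. Qed.

Lemma connected_linked P P' : P \in S -> P' \in S -> linked P P' ->
  connected_set (adj E) (P :|: P').
Proof.
move=> PS PS' /andP[PP' /exists_inP[e eX /andP[/pred0Pn[x /andP[xe xP]]]]].
case/pred0Pn=> y /andP[ye yP'].
have [eE e2] := edgeX M eX.
have xy : x != y.
  by apply: contraTneq yP' => <-; apply: disjoint_mem xP; apply: disjointS.
apply: connected_setU (connS M PS) (connS M PS') xP yP' _; first exact: adj_sym.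
rewrite /adj /= xy; suff -> : [set x; y] = e by [].
apply/eqP; rewrite eqEcard cards2 xy e2 andbT.
by apply/subsetP => z; rewrite !inE => /orP[] /eqP->.
Qed.

Lemma candidate_connected C : candidate C -> connected_set (adj E) C.
Proof.
case/andP=> _ /orP[/(connS M)//|].
case/exists_inP=> P PS /exists_inP[P' PS' /andP[lPP' /eqP->]].
exact: connected_linked.
Qed.

Lemma candidate_meets C : candidate C ->
  \sum_(P in S) ~~ [disjoint C & P] <= 2.
Proof.
move=> candC.
have [P [P' [PS PS' sub]]] :
    exists P P', [/\ P \in S, P' \in S & C \subset P :|: P'].
  case/andP: candC => _ /orP[CS|]; first by exists C, C; split=> //; apply: subsetUl.
  case/exists_inP=> P PS /exists_inP[P' PS' /andP[_ /eqP->]].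
  by exists P, P'.
rewrite -big_mkcondr /= sum1dep_card; apply: (@leq_trans #|[set P; P']|).
  apply: subset_leq_card; apply/subsetP => A; rewrite !inE => /andP[AS].
  apply: contraR; rewrite negb_or => /andP[AP AP'].
  apply: disjointWl sub _; rewrite -setI_eq0 setIUl setU_eq0 !setI_eq0.
  by rewrite !disjointS // eq_sym.
by rewrite cards2; case: eqP.
Qed.

(** A pair is itself an edge outside [X], and no other edge has both ends in it. *)
Lemma edge_meets_pair P e : P \in S -> e \in X -> #|e :&: P| <= 1.
Proof.
move=> PS eX; rewrite leqNgt; apply/negP => big.
have [_ PnX] := twoS M PS (S2 PS); have [_ e2] := edgeX M eX.
case/negP: PnX; suff -> : P = e by [].
have sub1 : e :&: P = e.
  by apply/eqP; rewrite eqEcard subsetIl e2.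
apply/esym/eqP; rewrite eqEcard e2 (S2 PS) leqnn andbT.
by apply/setIidPl.
Qed.

Variable F : {set {set 'I_n}}.
Hypothesis tF : trivIset F.
Hypothesis candF : forall C, C \in F -> candidate C.
Hypothesis maxF : forall C, candidate C -> ~~ [disjoint C & cover F].

Let R := [set P in S | [disjoint P & cover F]].

Lemma meets_cover P : ~~ [disjoint P & cover F] ->
  exists2 C, C \in F & ~~ [disjoint C & P].
Proof.
case/pred0Pn=> x /andP[xP /bigcupP[C CF xC]]; exists C => //.
by apply/pred0Pn; exists x; rewrite /= xC.
Qed.

(** Each member of [F] is made of at most two pairs, so it meets at most two. *)
Lemma card_leftover : #|S| <= #|R| + 2 * #|F|.
Proof.
rewrite -(cardsID R S) leq_add //.
  by apply: subset_leq_card; apply: subsetIr.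
rewrite mulnC -sum_nat_const.
apply: (@leq_trans (\sum_(P in S) \sum_(C in F) ~~ [disjoint C & P])); last first.
  by rewrite exchange_big /=; apply: leq_sum => C /candF/candidate_meets.
rewrite (big_setID R) /= -sum1_card; apply: leq_trans (leq_addl _ _).
apply: leq_sum => P; rewrite !inE => /andP[+ PS].
rewrite PS /= => /meets_cover[C CF CP].
by rewrite (bigD1 C) //= CP.
Qed.

(** Otherwise the pair itself would enlarge the maximal family [F]. *)
Lemma leftover_touch P : P \in R -> 2 <= touch X P.
Proof.
rewrite inE => /andP[PS dP]; have := slackS M PS.
have : ~~ (5 <= slack E P).
  by apply: contraL dP => s5; apply: maxF; rewrite /candidate s5 PS.
by clear; lia.
Qed.

(** Otherwise the union of the two pairs, whose slack is at least 12 minus the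
    number of hits, would enlarge [F]. *)
Lemma leftover_linked P P' : P \in R -> P' \in R -> linked P P' ->
  8 <= touch X P + touch X P'.
Proof.
rewrite !inE => /andP[PS dP] /andP[PS' dP'] lPP'.
have PP' : P != P' by case/andP: lPP'.
have : ~~ (5 <= slack E (P :|: P')).
  have dU : [disjoint P :|: P' & cover F].
    by rewrite -setI_eq0 setIUl setU_eq0 !setI_eq0 dP.
  apply: contraL dU => s5; apply: maxF; rewrite /candidate s5 /=; apply/orP; right.
  by apply/exists_inP; exists P => //; apply/exists_inP; exists P'; rewrite ?lPP' /=.
rewrite slackU ?disjointS //.
have := slackS M PS; have := slackS M PS'.
by clear; lia.
Qed.

(** What a leftover pair with [h] hits receives from each opponent's edge that
    hits it.  The values are such that every leftover pair receives at least 6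
    in total ([h * charge h >= 6] for [h >= 2]), although an edge pays at most 4:
    [charge h + charge h' <= 4] whenever [h, h' >= 2] and [h + h' >= 8]. *)
Definition charge h := if h <= 2 then 3 else if h <= 5 then 2 else 1.

Lemma charge_edge e : e \in X ->
  \sum_(P in R) charge (touch X P) * #|e :&: P| <= 4.
Proof.
move=> eX; set Re := [set P in R | ~~ [disjoint e & P]].
have RS P : P \in R -> P \in S by rewrite inE => /andP[].
have sumE : \sum_(P in R) charge (touch X P) * #|e :&: P|
    <= \sum_(P in Re) charge (touch X P).
  under [X in _ <= X]eq_bigl => P do rewrite inE.
  rewrite big_mkcondr /=; apply: leq_sum => P PR.
  have := edge_meets_pair (RS P PR) eX; rewrite -setI_eq0 -cards_eq0.
  by case: #|_| => [|[]] //= _; rewrite ?muln0 ?muln1.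
apply: leq_trans sumE _.
have charge3 h : charge h <= 3 by rewrite /charge; case: ifP => // _; case: ifP.
have [cRe|] := leqP #|Re| 1.
  apply: (@leq_trans (\sum_(P in Re) 3)); first by apply: leq_sum.
  by rewrite sum_nat_const; move: cRe; clear; lia.
move=> cRe; have : #|Re| <= 2.
  have [_ <-] := edgeX M eX.
  apply: leq_trans (sum_card_trivIset e (_ : trivIset Re)).
    rewrite -sum1_card; apply: leq_sum => P.
    by rewrite inE => /andP[_]; rewrite -setI_eq0 -card_gt0.
  by apply: trivIsetS (trivS M); apply/subsetP => P; rewrite inE => /andP[/RS].
rewrite leq_eqVlt ltnNge cRe orbF => /cards2P[P [P' [PP' ReE]]].
have /setIdP[PR eP] : P \in Re by rewrite ReE set21.
have /setIdP[PR' eP'] : P' \in Re by rewrite ReE set22.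
rewrite ReE big_setU1 ?inE //= big_set1.
have lPP' : linked P P'.
  by rewrite /linked PP'; apply/exists_inP; exists e; rewrite ?eP.
have := leftover_linked PR PR' lPP'.
have := leftover_touch PR; have := leftover_touch PR'.
rewrite /charge; move: (touch X P) (touch X P') => h h'; clear.
by do ![case: ifP]; lia.
Qed.

Lemma leftover_small : 6 * #|R| <= 4 * #|X|.
Proof.
rewrite mulnC -sum_nat_const [4 * _]mulnC -sum_nat_const.
apply: leq_trans (leq_sum _ (fun e => @charge_edge e)).
rewrite exchange_big /=; apply: leq_sum => P /leftover_touch.
rewrite -big_distrr /= -/(touch X P) /charge; move: (touch X P) => h; clear.
by do ![case: ifP]; lia.
Qed.

(** At most two thirds of the pairs are left over, so the family meets a third
    of them, at most two per member. *)
Lemma survivors_maximal : #|S| <= 6 * #|F|.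
Proof. by move: card_leftover leftover_small cX; clear; lia. Qed.

End Pairs.

Lemma survivors_pairs U0 E U S X :
    merging 4 U0 E U S X -> #|X| <= #|S| -> (forall P, P \in S -> #|P| = 2) ->
  exists2 F, family 5 E F & #|S| <= 6 * #|F|.
Proof.
move=> M cX S2.
pose p (F : {set {set 'I_n}}) := trivIset F && [forall C in F, candidate E S X C].
have p0 : p set0.
  apply/andP; split; first by apply/trivIsetP => A B; rewrite inE.
  by apply/forall_inP => C; rewrite inE.
have [F /maxsetP[/andP[tF /forall_inP candF] maxF] _] := maxset_exists p0.
exists F; first split=> // C /candF candC.
  by split; [exact: candidate_connected M _ candC | case/andP: candC].
apply: (survivors_maximal M) => // C candC; apply/negP => dC.
have C0 : C != set0 by case: (candidate_connected M candC).
have F0 : set0 \notin F.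
  by apply/negP => /candF/(candidate_connected M)[]; rewrite eqxx.
have dCF : {in F, forall B, [disjoint C & B]}.
  by move=> B BF; apply: disjointWr dC; apply: (bigcup_max B).
have [tCF] := trivIsetU1 dCF tF F0.
have eqF : C |: F = F.
  apply: maxF; last exact: subsetUr.
  by rewrite /p tCF; apply/forall_inP => B /setU1P[->//|]; exact: candF.
by have := setU11 C F; rewrite eqF => ->.
Qed.

End Survivors.

(** * Reaching the complete minor *)

Section Linking.

Variables n l : nat.
Implicit Types (E F : {set {set 'I_n}}) (B : 'I_l -> {set 'I_n}).

Lemma minorS E E' : E \subset E' ->
  minor (complete l) (adj E) -> minor (complete l) (adj E').
Proof.
move=> sub [B [conB disB adjB]]; exists B.
split=> [i||i j /adjB[x [y [xi yj xy]]]].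
- by apply: connected_setS (conB i); apply: adjS.
- exact: disB.
- by exists x, y; split; [exact: xi|exact: yj|exact: adjS xy].
Qed.

Definition nonadjacent E B : {set 'I_l * 'I_l} :=
  [set p | (p.1 != p.2) &&
     ~~ [exists x in B p.1, exists y in B p.2, adj E x y]].

Lemma nonadjacentS E E' B :
  E \subset E' -> nonadjacent E' B \subset nonadjacent E B.
Proof.
move=> sub; apply/subsetP => p; rewrite !inE => /andP[-> /=].
apply: contra => /exists_inP[x xB /exists_inP[y yB xy]].
apply/exists_inP; exists x => //; apply/exists_inP; exists y => //.
exact: adjS xy.
Qed.

(** Every round makes at least one more pair of branch sets adjacent, and lowers
    the slack of each branch set by at most 2 for either player's edge. *)
Lemma linking_phase k E B :
    (forall i, connected_set (adj E) (B i)) ->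
    (forall i j, i != j -> [disjoint B i & B j]) ->
    #|nonadjacent E B| <= k -> (forall i, 4 * k <= slack E (B i)) ->
  forced 4 (minor (complete l)) E.
Proof.
move=> + disB; elim: k E => [|k IH] E conB cN slB.
  have none : nonadjacent E B = set0 by apply/eqP; rewrite -cards_eq0 -leqn0.
  apply: forced_now; exists B; split=> // i j ij.
  have : (i, j) \notin nonadjacent E B by rewrite none inE.
  rewrite inE /= (ij : i != j) negbK => /exists_inP[x xi /exists_inP[y yj xy]].
  by exists x, y.
have [none|[[i j] Nij]] := set_0Vmem (nonadjacent E B).
  apply: IH => //; first by rewrite none cards0.
  by move=> i; apply: leq_trans (slB i); rewrite leq_mul2l leqnSn.
have := Nij; rewrite inE /= => /andP[ij far].
have free i' : 0 < slack E (B i') by apply: leq_trans (slB i').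
have [x xi dx] := slack_gt0 (free i); have [y yj dy] := slack_gt0 (free j).
have nadj : ~~ adj E x y.
  apply: contra far => xy; apply/exists_inP; exists x => //.
  by apply/exists_inP; exists y.
have xy : x != y by apply: contraTneq yj => <-; apply: disjoint_mem xi; apply: disB.
have le := legal_intro xy nadj dx dy; set e := [set x; y] in le.
have sub : E \subset e |: E by apply: subsetUr.
have cN' E' : e |: E \subset E' -> #|nonadjacent E' B| <= k.
  move=> sub'; rewrite -ltnS; apply: leq_trans cN; apply: proper_card.
  apply/properP; split; first by apply: nonadjacentS; apply: subset_trans sub'.
  exists (i, j) => //; rewrite inE /= ij negbK; apply/exists_inP; exists x => //.
  apply/exists_inP; exists y => //; apply: adjS sub' _ _ _.
  by rewrite /adj /= xy setU11.
have con' E' : e |: E \subset E' -> forall i, connected_set (adj E') (B i).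
  move=> sub' i'; apply: connected_setS (conB i'); apply: adjS.
  exact: subset_trans sub'.
have drop E' (e' : {set 'I_n}) i' :
    #|e'| = 2 -> slack E' (B i') <= slack (e' |: E') (B i') + 2.
  move=> e2; apply: leq_trans (slack_add _ _ e2) _.
  by rewrite leq_add2l -[in X in _ <= X]e2 subset_leq_card // subsetIl.
have sl1 i' : 4 * k + 2 <= slack (e |: E) (B i').
  by have := drop E e i' (legal_card le); have := slB i'; clear; lia.
apply: (forced_move le) => [|e' le'].
  apply: IH; [exact: con'|exact: cN'|move=> i'].
  by apply: leq_trans (sl1 i'); apply: leq_addr.
have sub' : e |: E \subset e' |: (e |: E) by apply: subsetUr.
apply: IH; [exact: con'|exact: cN'|move=> i'].
by have := drop (e |: E) e' i' (legal_card le'); have := sl1 i'; clear; lia.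
Qed.

Lemma linking_family c E F :
  4 * (l * l) <= c -> family c E F -> l <= #|F| ->
  forced 4 (minor (complete l)) E.
Proof.
move=> cl [tF famF] lF.
pose B (i : 'I_l) : {set 'I_n} := enum_val (widen_ord lF i).
have BF i : B i \in F by apply: enum_valP.
apply: (@linking_phase (l * l) E B).
- by move=> i; case: (famF _ (BF i)).
- move=> i j ij; move/trivIsetP: tF; apply=> //.
  by apply: contraNneq ij => /enum_val_inj/(congr1 val) /= /val_inj->.
- by apply: leq_trans (max_card _) _; rewrite card_prod card_ord.
- by move=> i; apply: leq_trans cl _; case: (famF _ (BF i)).
Qed.

End Linking.

Lemma merging_start n c (E F : {set {set 'I_n}}) :
  family c E F -> merging c F E F set0 set0.
Proof.
case=> tF famF; split.
- exact: tF.
- by apply/trivIsetP => A B; rewrite inE.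
- exact: subxx.
- by move=> A /famF[].
- by move=> A /famF[].
- by move=> A P _; rewrite inE.
- by move=> A e _; rewrite inE.
all: by move=> P; rewrite inE.
Qed.

Lemma merging_family n (Q : rel 'I_n -> Prop) c T (E F : {set {set 'I_n}}) :
    0 < c -> family c E F -> 4 * T <= #|F| ->
    (forall E' U S X, merging c F E' U S X -> #|S| = T -> #|X| <= #|S| ->
       forced 4 Q E') ->
  forced 4 Q E.
Proof.
move=> c0 famF cF fin.
apply: (merging_phase (T := T) (k := T) c0 (merging_start famF)).
- by rewrite cards0.
- exact: cF.
- by rewrite !cards0.
- by move=> E' U S X M cS cX; apply: (fin _ _ _ _ M cS); rewrite cS.
Qed.

(** Induction on the missing slack [d].  The factor 12 is 4 sets consumed per
    union times 3 unions per survivor. *)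
Lemma large_family_forced l d : exists N, forall n c (E F : {set {set 'I_n}}),
  5 <= c -> 4 * (l * l) <= c + d -> family c E F -> N <= #|F| ->
  forced 4 (minor (complete l)) E.
Proof.
elim: d => [|d [N IH]].
  exists l => n c E F _; rewrite addn0; exact: linking_family.
exists (12 * N) => n c E F c5 cl famF cF.
apply: (merging_family (T := 3 * N) (ltnW (ltnW (ltnW (ltnW c5)))) famF).
  by move: cF; clear; lia.
move=> E' U S X M cS cX; have [F' famF' cF'] := survivors_large c5 M cX.
apply: IH famF' _; [by apply: leq_trans c5 _|by move: cl; clear; lia|].
by move: cF'; rewrite cS leq_mul2l.
Qed.

Lemma isolated_family n (E : {set {set 'I_n}}) (D : {set 'I_n}) :
  (forall x, x \notin D -> degree (adj E) x = 0) ->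
  family 4 E [set [set x] | x in ~: D].
Proof.
move=> degD; split=> [|A /imsetP[x + ->]].
  apply/trivIsetP => A B /imsetP[x _ ->] /imsetP[y _ ->] xy.
  by rewrite disjoints1 inE; apply: contra xy => /eqP->.
rewrite inE => /degD dx; split; first exact: connected_set1.
by rewrite /slack big_set1 dx.
Qed.

(** The set [D] allows for a first move of the opponent.  The factor 24 is 4
    vertices consumed per pair times 6 pairs per survivor. *)
Lemma sparse_forced l : exists n0, forall n (E : {set {set 'I_n}}) (D : {set 'I_n}),
  n0 <= n -> #|D| <= 2 -> (forall x, x \notin D -> degree (adj E) x = 0) ->
  forced 4 (minor (complete l)) E.
Proof.
have [N IH] := large_family_forced l (4 * (l * l)).
exists (24 * N + 2) => n E D n0n D2 degD.
apply: (merging_family (T := 6 * N) (isT : 0 < 4) (isolated_family degD)).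
  rewrite card_imset; last exact: set1_inj.
  by have := cardsC D; rewrite card_ord; move: n0n D2;
    move: #|D| #|~: D|; clear; lia.
move=> E' U S X M cS cX.
have [|F' famF' cF'] := survivors_pairs M cX.
  move=> P /(pairS M)[A [B [/imsetP[x _ ->] /imsetP[y _ ->] xy ->]]].
  by rewrite cards2; suff -> : x != y by []; apply: contraNneq xy => ->.
apply: IH famF' _ => //; first exact: leq_addl.
by move: cF'; rewrite cS leq_mul2l.
Qed.

(** * The theorem *)

Theorem theorem1p2 (l : nat) (l_gt0 : 0 < l) :
  exists n0 : nat, forall n : nat, n0 <= n ->
    forall first designated : bool,
      can_ensure 4 first designated
        (fun G : rel 'I_n => minor (complete l) G).
Proof.
have [n0 win] := sparse_forced l; exists n0 => n n0n first designated.
have deg0 (x : 'I_n) : degree (adj set0) x = 0.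
  by apply: eq_card0 => y; rewrite inE /adj /= !inE andbF.
apply: can_ensure_forced => [E E'||e le]; first exact: minorS.
  by apply: (win n set0 set0 n0n) => //; rewrite cards0.
apply: (win n (e |: set0) e n0n) => [|x xe]; first by rewrite (legal_card le).
by have := degree_add set0 x (legal_card le); rewrite deg0 (negbTE xe) leqn0 => /eqP.
Qed.
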